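(* For every nonnegative integer $n$, $$\overline{p}_o(n)=\sum_{j=0}^{\infty}pod\!\left(n-\frac{j(j+1)}{2}\right).$$
   Context: $pod(n)$ denotes the number of partitions of $n$ in which odd parts are distinct and even parts may be repeated, with $pod(0)=1$ and $pod(m)=0$ for $m<0$. An overpartition of $n$ is a non-increasing sequence of positive integers with sum $n$ in which the first occurrence of each number may be overlined; $\overline{p}_o(n)$ is the number of overpartitions of $n$ into odd parts, with $\overline{p}_o(0)=1$. *)

(* Defs.v *)
From mathcomp Require Import all_boot all_order all_algebra.
From mathcomp Require Import classical_sets functions cardinality fsbigop.

Set Implicit Arguments.
Unset Strict Implicit.
Unset Printing Implicit Defensive.

Local Open Scope nat_scope.

Definition is_partition (n : nat) (s : seq nat) : bool :=
  [&& sorted geq s, all (ltn 0) s & sumn s == n].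

(* A partition of n has at most n parts, each at most n (see the two lemmas
   below), so the partitions of n are the k-tuples over 'I_n.+1 with k <= n
   whose values satisfy is_partition n; this makes the counting finite. *)
Lemma is_partition_size (n : nat) (s : seq nat) :
  is_partition n s -> size s <= n.
Proof.
case/and3P=> _ + /eqP <-; elim: s => //= x s IHs /andP[x_gt0 /IHs].
by rewrite -add1n; apply: leq_add.
Qed.

Lemma is_partition_part_le (n : nat) (s : seq nat) :
  is_partition n s -> all (fun x => x <= n) s.
Proof.
case/and3P=> _ _ /eqP <-; elim: s => //= x s IHs; rewrite leq_addr /=.
by apply: sub_all IHs => y /leq_trans; apply; apply: leq_addl.
Qed.

Definition is_pod (n : nat) (s : seq nat) : bool :=
  is_partition n s && uniq [seq x <- s | odd x].

Definition pod_nat (n : nat) : nat :=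
  \sum_(k < n.+1) #|[set t : k.-tuple 'I_n.+1 | is_pod n [seq val x | x <- t]]|.

Definition pod (m : int) : nat := if m is Posz n then pod_nat n else 0.

(* Each part carries a flag telling whether it is overlined; the flag may be
   set only at the first occurrence of the part. *)
Definition is_overpartition (n : nat) (s : seq (nat * bool)) : bool :=
  is_partition n (unzip1 s) &&
  all (fun i => (nth (0, false) s i).2 ==>
                (index (nth (0, false) s i).1 (unzip1 s) == i))
      (iota 0 (size s)).

Definition is_odd_overpartition (n : nat) (s : seq (nat * bool)) : bool :=
  is_overpartition n s && all odd (unzip1 s).

Definition overp_odd (n : nat) : nat :=
  \sum_(k < n.+1)
    #|[set t : k.-tuple ('I_n.+1 * bool) |
        is_odd_overpartition n [seq (val x.1, x.2) | x <- t]]|.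

(* Main.v *)
(* The generating functions are prod (1 + q^(2k+1)) / (1 - q^(2k+1)) for
   overpartitions into odd parts and prod (1 + q^(2k+1)) / (1 - q^(2k+2)) for
   pod, so the theorem is equivalent to Gauss's identity
   sum_j q^(j(j+1)/2) = prod (1 - q^(2k+2)) / (1 - q^(2k+1)).
   The latter is the limit of Shanks' finite identity
     sum_(j < 2n) q^(j(j+1)/2) = sum_(s < n) (P_n / P_s) q^(s(2n+1)),
   with P_n = prod_(k < n) (1 - q^(2k+2)) / (1 - q^(2k+1)), which follows by
   telescoping.  Power series become polynomials modulo X^N; all
   identities are kept free of denominators, which have constant term 1 and
   hence can be cancelled modulo X^N. *)
Require Import Defs.
From mathcomp Require Import all_boot all_order all_algebra.
From mathcomp Require Import classical_sets functions cardinality fsbigop.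
From mathcomp Require Import ring zify.

Set Implicit Arguments.
Unset Strict Implicit.
Unset Printing Implicit Defensive.

Import GRing.Theory Num.Theory.
Local Open Scope ring_scope.

(** * Triangular numbers and Shanks' finite identity *)

Definition triangular (j : nat) : nat := ((j * (j + 1)) %/ 2)%N.

Lemma triangular_double n : triangular (2 * n) = (n * (2 * n + 1))%N.
Proof. by rewrite /triangular -mulnA mulKn. Qed.

Lemma triangular_doubleS n : triangular (2 * n).+1 = (n.+1 * (2 * n + 1))%N.
Proof.
rewrite /triangular (_ : (_.+1 * _ = 2 * (n.+1 * (2 * n + 1)))%N) ?mulKn //.
by lia.
Qed.

Lemma leq_triangular j : (j <= triangular j)%N.
Proof. by rewrite /triangular; nia. Qed.

Section Shanks.

Variables (R : comPzRingType) (q : R).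

Definition odd_prod (n : nat) : R := \prod_(k < n) (1 - q ^+ (2 * k).+1).
Definition even_prod (m n : nat) : R :=
  \prod_(m <= k < n) (1 - q ^+ (2 * k).+2).
(** Shanks' summand [(P_n / P_s) q^(s(2n+1))] multiplied by [odd_prod n], which clears its
    denominator. *)
Definition shanks_term (n s : nat) : R :=
  even_prod s n * odd_prod s * q ^+ (s * (2 * n + 1)).

Lemma odd_prodS n : odd_prod n.+1 = odd_prod n * (1 - q ^+ (2 * n).+1).
Proof. by rewrite /odd_prod big_ord_recr. Qed.

Lemma even_prodS m n : (m <= n)%N ->
  even_prod m n.+1 = even_prod m n * (1 - q ^+ (2 * n).+2).
Proof. by move=> le_mn; rewrite /even_prod big_nat_recr. Qed.

(** The right-hand side is a partial sum in closed form: it vanishes at [m = 0] because of the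
    factor [1 - q^(2m)], and its increment from [m] to [m.+1] is the summand with index [m]. *)
Lemma shanks_telescope n m : (m <= n)%N ->
  \sum_(s < m) shanks_term n.+1 s
    - (1 - q ^+ (2 * n).+1) * (\sum_(s < m) shanks_term n s)
  = (1 - q ^+ (2 * m)) * shanks_term n m.
Proof.
elim: m => [|m IHm] lt_mn; first by rewrite !big_ord0 muln0 expr0; ring.
have := IHm (ltnW lt_mn); rewrite !big_ord_recr /= => /eqP.
rewrite subr_eq => /eqP ->.
rewrite /shanks_term even_prodS 1?ltnW // odd_prodS.
(* Every term now shares the factor [even_prod m.+1 n]; splitting the exponents leaves an identity
   that is polynomial in [q], [q^m] and [q^n]. *)
have -> : even_prod m n = (1 - q ^+ (2 * m).+2) * even_prod m.+1 n.
  by rewrite /even_prod big_ltn.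
have -> : (m * (2 * n.+1 + 1) = m * (2 * n + 1) + m + m)%N by lia.
have -> : (m.+1 * (2 * n + 1) = m * (2 * n + 1) + n + n + 1)%N by lia.
have -> : (2 * m.+1 = m + m + 2)%N by lia.
rewrite !mul2n -!addnn -[(n + n).+2]addn2 -[(n + n).+1]addn1.
rewrite -[(m + m).+2]addn2 -[(m + m).+1]addn1 !exprD.
ring.
Qed.

(* Shanks' finite form of Gauss's identity, multiplied by [odd_prod n] to
   avoid division. *)
Lemma shanks_identity n :
  odd_prod n * (\sum_(k < 2 * n) q ^+ triangular k)
  = \sum_(s < n) shanks_term n s.
Proof.
elim: n => [|n IHn]; first by rewrite muln0 !big_ord0 mulr0.
have /eqP := shanks_telescope (leqnn n); rewrite subr_eq => /eqP tele.
(* What remains is that the telescoped value and the new summand [s = n] produce the two new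
   triangular powers: [(1 - q^(2n)) + q^(2n) (1 - q^(2n+2)) = (1 - q^(2n+1)) (1 + q^(2n+1))]. *)
rewrite [RHS]big_ord_recr /= tele -IHn mulnS add2n !big_ord_recr /=.
rewrite triangular_double triangular_doubleS /shanks_term odd_prodS.
rewrite even_prodS // /even_prod big_geq // mul1r.
have -> : (n.+1 * (2 * n + 1) = n * (2 * n + 1) + n + n + 1)%N by lia.
have -> : (n * (2 * n.+1 + 1) = n * (2 * n + 1) + n + n)%N by lia.
rewrite !mul2n -!addnn -[(n + n).+2]addn2 -[(n + n).+1]addn1 !exprD.
ring.
Qed.

End Shanks.

(** * Congruences modulo ['X^N], written as divisibility *)

Section Truncation.

Implicit Types (p r : {poly rat}) (N : nat).

Lemma dvdp_XnP N p :
  reflect (forall i, (i < N)%N -> p`_i = 0) ('X^N %| p).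
Proof.
apply: (iffP idP) => [/dvdpP[r ->] i lt_iN | p0]; first by rewrite coefMXn lt_iN.
rewrite -(poly_take_drop N p) (_ : take_poly N p = 0) ?add0r ?dvdp_mull //.
by apply/polyP=> i; rewrite coef_take_poly coef0; case: ifP => // /p0.
Qed.

(** In Shanks' identity at [q = 'X], the summand [s = 0] is the even product, and each [s > 0]
    carries the exponent [s(2N+1) >= N]. *)
Lemma gauss_mod N :
  'X^N %| odd_prod ('X : {poly rat}) N * (\sum_(k < 2 * N) 'X^(triangular k))
          - even_prod 'X 0 N.
Proof.
rewrite shanks_identity; case: N => [|N]; first by rewrite expr0 dvd1p.
rewrite big_ord_recl {1}/shanks_term /odd_prod big_ord0 !mulr1.
rewrite addrC addrA addNr add0r; apply: (big_ind (fun p => 'X^_ %| p)) => [|p r|i _].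
- exact: dvdp0.
- exact: dvdp_add.
by rewrite dvdp_mull // dvdp_exp2l //= /bump; nia.
Qed.

(** A polynomial with nonzero constant term is coprime to ['X], hence to its powers. *)
Lemma dvdp_Xn_cancel N (D p : {poly rat}) :
  D.[0] != 0 -> 'X^N %| D * p -> 'X^N %| p.
Proof.
by move=> D0; rewrite Gauss_dvdpr // coprimep_expl // coprimep_sym coprimepX.
Qed.

End Truncation.

(** * Recurrences obtained by removing the largest part *)

Section Counting.

Local Open Scope nat_scope.

(** Replaces tuple types that depend on [n] by one list [L], on which partitions of different
    integers can be compared. The members of [L] satisfying [P] are grouped by length; those of
    length [k] correspond to [k]-tuples through [map f]. *)
Lemma sum_card_tuples (T : finType) (U : eqType) (f : T -> U) (n : nat)
    (P : pred (seq U)) (L : seq (seq U)) :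
  injective f -> uniq L -> {subset P <= L} ->
  (forall s, P s -> size s <= n /\ exists t, s = map f t) ->
  \sum_(k < n.+1) #|[set t : k.-tuple T | P (map f t)]| = count P L.
Proof.
move=> f_inj L_uniq PL Pf; rewrite -sum1_count.
(* [inord] is faithful here, since [P] forces [size s <= n]. *)
rewrite (partition_big (fun s => inord (size s) : 'I_n.+1) xpredT) //=.
apply: eq_bigr => k _; rewrite sum1_count cardE -size_filter.
rewrite -(size_map (fun t : k.-tuple T => map f t)).
apply: perm_size; apply: uniq_perm.
- by rewrite map_inj_uniq ?enum_uniq // => t u /(inj_map f_inj) /val_inj.
- exact: filter_uniq.
move=> s; rewrite mem_filter; apply/mapP/idP => [[t]|].
  rewrite mem_enum inE => Pt ->; rewrite Pt size_map size_tuple inord_val eqxx.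
  exact: PL.
case/andP=> /andP[Ps /eqP sk] _; have [le_sn [t s_t]] := Pf _ Ps.
have tk : size t == k.
  by rewrite -sk inordK -?(size_map f) -?s_t ?ltnS.
by exists (Tuple tk); rewrite ?mem_enum ?inE /= -s_t.
Qed.

(** [cons x] is a bijection from the sequences in [Q] onto the second alternative of [P]; the last
    hypothesis makes the two alternatives disjoint. *)
Lemma count_cons (T : eqType) (L : seq (seq T)) (x : T)
    (P Q R : pred (seq T)) :
  uniq L -> {subset P <= L} -> {subset Q <= L} ->
  (forall s, P s = R s || (if s is y :: s' then (y == x) && Q s' else false)) ->
  (forall s, Q s -> ~~ R (x :: s)) ->
  count P L = count R L + count Q L.
Proof.
move=> L_uniq PL QL P_E QR.
pose C s := if s is y :: s' then (y == x) && Q s' else false.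
rewrite (eq_count (a2 := predU R C)) //.
have := count_predUI R C L; rewrite (@eq_count _ (predI R C) pred0); last first.
  case=> [|y s] /=; first by rewrite andbF.
  by apply/negbTE/negP=> /and3P[Rys /eqP yx /QR]; rewrite -yx Rys.
rewrite count_pred0 addn0 => ->; congr (_ + _).
rewrite -!size_filter -(size_map (cons x) (filter Q L)).
apply: perm_size; apply: uniq_perm; first exact: filter_uniq.
  by rewrite map_inj_uniq ?filter_uniq // => s t [].
move=> s; rewrite mem_filter; apply/andP/mapP => [[]|[t]].
  case: s => //= y s /andP[/eqP-> Qs] _; exists s => //.
  by rewrite mem_filter Qs QL.
rewrite mem_filter => /andP[Qt _] ->; rewrite /= eqxx Qt; split=> //.
by apply: PL; rewrite -topredE /= P_E /= eqxx Qt orbT.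
Qed.

Fixpoint bounded_seqs (T : eqType) (A : seq T) (n : nat) : seq (seq T) :=
  if n is n'.+1 then
    [::] :: [seq x :: s | x <- A, s <- bounded_seqs A n'] else [:: [::]].

Lemma mem_bounded_seqs (T : eqType) (A : seq T) n s :
  all (mem A) s -> size s <= n -> s \in bounded_seqs A n.
Proof.
elim: n s => [|n IHn] [|x s] //= /andP[xA sA] le_sn.
by rewrite inE /=; apply/allpairsP; exists (x, s); split=> //; apply: IHn.
Qed.

Lemma is_partition_ord (n : nat) (s : seq nat) :
  is_partition n s -> exists t : seq 'I_n.+1, s = map val t.
Proof.
move/is_partition_part_le => /allP le_sn; exists (map inord s).
by rewrite -map_comp map_id_in // => x /le_sn; rewrite -ltnS => /inordK.
Qed.

(** The bound [k] is the induction parameter: raising it by one contributes one factor of the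
    product. *)
Definition pod_upto (k m : nat) (s : seq nat) : bool :=
  is_pod m s && all (geq k) s.

Lemma geq_trans : transitive geq.
Proof. by move=> y x z /= ? /leq_trans; apply. Qed.

Lemma pod_uptoE k m s : pod_upto k m s =
  [&& path geq k s, all (ltn 0) s, sumn s == m & uniq [seq x <- s | odd x]].
Proof.
rewrite /pod_upto /is_pod /is_partition path_sortedE; last exact: geq_trans.
by case: (all (geq k) s); rewrite /= ?andbT ?andbF // -!andbA.
Qed.

Lemma pod_upto0 m s : pod_upto 0 m s = (s == [::]) && (m == 0).
Proof.
rewrite pod_uptoE; case: s => [|x s] /=; first by rewrite andbT eq_sym.
by rewrite leqn0; case: x => //=; rewrite andbF.
Qed.

(** If [k.+1] occurs, it comes first. Once it is removed, an even [k.+1] may occur again, whereas an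
    odd one may not, so the bound drops to [k]. *)
Lemma pod_uptoS k m s : pod_upto k.+1 m s = pod_upto k m s ||
  (if s is y :: s' then (y == k.+1) &&
     ((k.+1 <= m) && pod_upto (if odd k.+1 then k else k.+1) (m - k.+1) s')
   else false).
Proof.
rewrite !pod_uptoE; case: s => [|y s] /=; first by rewrite orbF.
rewrite leq_eqVlt ltnS; case: eqP => [->|_] /=; last by rewrite orbF.
rewrite ltnn /=; rewrite pod_uptoE.
have -> : (k.+1 + sumn s == m) = (k.+1 <= m) && (sumn s == m - k.+1) by lia.
case: ifP => odd_k /=; last first.
  by case: (_ <= _); rewrite ?andbF //=; do !bool_congr.
rewrite mem_filter /= odd_k /=.
have -> : path geq k s = path geq k.+1 s && (k.+1 \notin s).
  rewrite !path_sortedE; try exact: geq_trans.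
  rewrite andbAC; congr (_ && _); apply/allP/andP => [le_sk|[/allP le_sk ks] x xs].
    split; first by apply/allP=> x /le_sk /= /leqW.
    by apply/negP=> /le_sk; rewrite /= ltnn.
  by have := le_sk x xs; rewrite /= leq_eqVlt => /orP[/eqP xk|//]; rewrite -xk xs in ks.
by case: (_ <= m); rewrite ?andbF //=; case: (path _ _ _); case: (_ \notin _);
  rewrite /= ?andbF ?andbT.
Qed.

Fixpoint overline_ok (s : seq (nat * bool)) : bool :=
  if s is x :: s' then
    all (fun y => y.2 ==> (y.1 != x.1)) s' && overline_ok s' else true.

(** Position 0 is always a first occurrence; position [i.+1] of [x :: s] is one exactly when its
    part differs from that of [x] and position [i] is one in [s]. *)
Lemma overline_okE (s : seq (nat * bool)) :
  all (fun i => (nth (0, false) s i).2 ==>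
                (index (nth (0, false) s i).1 (unzip1 s) == i))
      (iota 0 (size s)) = overline_ok s.
Proof.
elim: s => //= x s <-; rewrite eqxx implybT /= -[1]addn0 iotaDl all_map.
rewrite -[X in _ = all _ X && _](mkseq_nth (0, false)) /mkseq all_map -all_predI.
apply: eq_all => i /=; set y := nth _ _ _.
by rewrite [x.1 == _]eq_sym; case: (y.1 == x.1) => //=; case: y.2.
Qed.

Definition over_upto (k m : nat) (s : seq (nat * bool)) : bool :=
  is_odd_overpartition m s && all (geq k) (unzip1 s).

Definition no_overlined (k : nat) (s : seq (nat * bool)) : bool :=
  all (fun y => y.2 ==> (y.1 != k)) s.

(** An intermediate class that splits the factor [(1 + q^k) / (1 - q^k)]: copies of [k] without
    overline give [1 / (1 - q^k)], and an optional overlined copy gives [1 + q^k]. *)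
Definition plain_upto (k m : nat) (s : seq (nat * bool)) : bool :=
  over_upto k m s && no_overlined k s.

Lemma over_uptoE k m s : over_upto k m s =
  [&& path geq k (unzip1 s), all (ltn 0) (unzip1 s), sumn (unzip1 s) == m,
      overline_ok s & all odd (unzip1 s)].
Proof.
rewrite /over_upto /is_odd_overpartition /is_overpartition overline_okE.
rewrite /is_partition path_sortedE; last exact: geq_trans.
by case: (all (geq k) _); rewrite /= ?andbT ?andbF // -!andbA.
Qed.

Lemma over_upto0 m s : over_upto 0 m s = (s == [::]) && (m == 0).
Proof.
rewrite over_uptoE; case: s => [|[x b] s] /=; first by rewrite andbT eq_sym.
by rewrite leqn0; case: x => //=; rewrite andbF.
Qed.

Lemma over_upto_even k m s :
  ~~ odd k.+1 -> over_upto k.+1 m s = over_upto k m s.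
Proof.
move=> odd_k; rewrite !over_uptoE; case: s => //= -[y b] s /=.
rewrite leq_eqVlt ltnS; case: eqP => //= ->; rewrite (negbTE odd_k) ltnn.
by rewrite !andbF.
Qed.

Lemma path_lt_no_overlined k y s :
  y < k -> path geq y (unzip1 s) -> no_overlined k s.
Proof.
move=> lt_yk; rewrite path_sortedE; last exact: geq_trans.
case/andP=> le_sy _; rewrite all_map in le_sy; apply: sub_all le_sy => z /= le_zy.
by rewrite ltn_eqF ?implybT // (leq_ltn_trans le_zy).
Qed.

(** An overlined [k] is a first occurrence of the largest allowed part, so it heads the sequence,
    and no further copy of [k] is overlined. *)
Lemma over_upto_odd k m s : odd k -> over_upto k m s = plain_upto k m s ||
  (if s is y :: s' then (y == (k, true)) &&
     ((k <= m) && plain_upto k (m - k) s') else false).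
Proof.
move=> odd_k; rewrite /plain_upto !over_uptoE.
case: s => [|[y b] s] /=; first by rewrite /no_overlined /= !andbT orbF.
rewrite over_uptoE xpair_eqE; case: (ltngtP y k) => [lt_yk|//|->] /=.
  have [y_s|_] //= := boolP (path geq y (unzip1 s)).
  by rewrite -/(no_overlined _ s) (path_lt_no_overlined lt_yk y_s) implybT !andbT orbF.
rewrite odd_k -/(no_overlined k s) /=.
have -> : (k + sumn (unzip1 s) == m) = (k <= m) && (sumn (unzip1 s) == m - k) by lia.
by case: b; case: (k <= m); case: (no_overlined k s);
  rewrite /= ?andbF ?andbT ?orbF //= ?odd_gt0.
Qed.

(** Removing a plain [k.+1] stays in the same class; this self-reference encodes the geometric
    series [1 / (1 - q^(k+1))]. *)
Lemma plain_upto_odd k m s : odd k.+1 -> plain_upto k.+1 m s = over_upto k m s ||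
  (if s is y :: s' then (y == (k.+1, false)) &&
     ((k.+1 <= m) && plain_upto k.+1 (m - k.+1) s') else false).
Proof.
move=> odd_k; rewrite /plain_upto !over_uptoE.
case: s => [|[y b] s] /=; first by rewrite /no_overlined /= !andbT orbF.
rewrite over_uptoE xpair_eqE; case: (ltngtP y k.+1) => [lt_yk|lt_ky|->] /=.
- rewrite (_ : y <= k) // orbF /=.
  have [y_s|_] //= := boolP (path geq y (unzip1 s)).
  by rewrite -/(no_overlined _ s) (path_lt_no_overlined lt_yk y_s) implybT !andbT.
- by rewrite leqNgt (ltnW lt_ky).
rewrite ltnn [~~ odd k]odd_k -/(no_overlined k.+1 s) /=.
have -> : (k.+1 + sumn (unzip1 s) == m)
  = (k.+1 <= m) && (sumn (unzip1 s) == m - k.+1) by lia.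
by case: b; case: (k < m); case: (no_overlined _ s); rewrite /= ?andbF ?andbT.
Qed.

End Counting.

(** * Truncated generating functions and their products *)

Section GeneratingFunctions.

Variable N : nat.

Definition gf (f : nat -> nat) : {poly rat} := \poly_(m < N) (f m)%:R.

Definition distinct_odd_prod (K : nat) : {poly rat} :=
  \prod_(k < K) (1 + 'X^((2 * k).+1)).

(** [count_cons] read coefficientwise: prepending a part of size [a] multiplies by ['X^a]. The guard
    [a <= m] protects the truncated subtraction [m - a]. *)
Lemma gf_cons (T : eqType) (L : seq (seq T)) (x : T) (a : nat)
    (P Q R : nat -> pred (seq T)) :
  uniq L ->
  (forall m s, (m < N)%N -> P m s -> s \in L) ->
  (forall m s, (m < N)%N -> Q m s -> s \in L) ->
  (forall m s, P m s = R m s ||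
     (if s is y :: s' then (y == x) && ((a <= m)%N && Q (m - a)%N s') else false)) ->
  (forall m s, ~~ R m (x :: s)) ->
  'X^N %| gf (fun m => count (P m) L)
          - (gf (fun m => count (R m) L) + 'X^a * gf (fun m => count (Q m) L)).
Proof.
move=> L_uniq PL QL P_E Rx; apply/dvdp_XnP => m lt_mN.
have lt_maN : (m - a < N)%N by rewrite (leq_ltn_trans (leq_subr _ _)).
rewrite coefB coefD coefXnM !coef_poly lt_mN lt_maN.
rewrite (@count_cons _ L x (P m) (fun s => (a <= m)%N && Q (m - a)%N s) (R m)) //.
- rewrite natrD ltnNge; case: (a <= m)%N => /=; first by rewrite subrr.
  by rewrite count_pred0 subrr.
- by move=> s; apply: PL.
- by move=> s /andP[_]; apply: QL.
Qed.

Lemma gf_delta (f : nat -> nat) :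
  (forall m, (m < N)%N -> f m = (m == 0%N)) -> 'X^N %| gf f - 1.
Proof.
move=> f_E; apply/dvdp_XnP => m lt_mN.
by rewrite coefB coef_poly lt_mN coef1 f_E ?subrr.
Qed.

Section Pod.

Variable L : seq (seq nat).
Hypothesis L_uniq : uniq L.
Hypothesis mem_L : forall m s, (m < N)%N -> is_partition m s -> s \in L.

Let pod_gf k := gf (fun m => count (pod_upto k m) L).

Lemma pod_upto_mem k m s : (m < N)%N -> pod_upto k m s -> s \in L.
Proof. by move=> lt_mN /andP[/andP[part_s _] _]; apply: mem_L part_s. Qed.

Lemma pod_gfS k : 'X^N %| pod_gf k.+1
  - (pod_gf k + 'X^(k.+1) * pod_gf (if odd k.+1 then k else k.+1)).
Proof.
apply: (gf_cons L_uniq (pod_upto_mem (k := _)) (pod_upto_mem (k := _))) => m s.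
  exact: pod_uptoS.
by rewrite pod_uptoE /= ltnn.
Qed.

(** Each step admits the part [2K+1] at most once, giving a factor [1 + x1], and the part [2K+2] any
    number of times, giving a factor [1 - x2] on the denominator side. *)
Lemma pod_gf_prod K :
  'X^N %| pod_gf (2 * K) * even_prod 'X 0 K - distinct_odd_prod K.
Proof.
elim: K => [|K IHK].
  rewrite /even_prod big_geq // mulr1 /distinct_odd_prod big_ord0.
  apply: gf_delta => m lt_mN; rewrite (eq_count (pod_upto0 m)).
  case: m lt_mN => [|m] lt_mN; last first.
    by rewrite (@eq_count _ _ pred0) ?count_pred0 // => s; rewrite andbF.
  rewrite (@eq_count _ _ (pred1 [::])) => [|s]; last by rewrite andbT.
  by rewrite count_uniq_mem // (mem_L lt_mN).
have := pod_gfS (2 * K); have := pod_gfS (2 * K).+1.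
rewrite mulnS add2n even_prodS // /distinct_odd_prod big_ord_recr.
rewrite -/(distinct_odd_prod K) /= oddM /=.
set p2 := pod_gf _.+2; set p1 := pod_gf _.+1.
move: IHK; set p0 := pod_gf _.
set A := even_prod _ _ _; set O := distinct_odd_prod _ => h0 h2 h1.
set x1 := 'X^(_.+1) in h1 *; set x2 := 'X^(_.+2) in h2 *.
(* The goal is a combination of the two recurrences and the induction hypothesis. *)
rewrite (_ : _ - _ = (p2 - (p1 + x2 * p2)) * A + (p1 - (p0 + x1 * p0)) * A
  + (p0 * A - O) * (1 + x1)); last by ring.
by do ![apply: dvdp_add]; apply: dvdp_mulr.
Qed.

End Pod.

Section Over.

Variable L : seq (seq (nat * bool)).
Hypothesis L_uniq : uniq L.
Hypothesis mem_L :
  forall m s, (m < N)%N -> is_partition m (unzip1 s) -> s \in L.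

Let over_gf k := gf (fun m => count (over_upto k m) L).
Let plain_gf k := gf (fun m => count (plain_upto k m) L).

Lemma over_upto_mem k m s : (m < N)%N -> over_upto k m s -> s \in L.
Proof.
by move=> lt_mN /andP[/andP[/andP[part_s _] _] _]; apply: mem_L part_s.
Qed.

Lemma plain_upto_mem k m s : (m < N)%N -> plain_upto k m s -> s \in L.
Proof. by move=> lt_mN /andP[/over_upto_mem + _]; apply. Qed.

Lemma over_gf_plain k :
  odd k -> 'X^N %| over_gf k - (plain_gf k + 'X^k * plain_gf k).
Proof.
move=> odd_k.
apply: (gf_cons L_uniq (over_upto_mem (k := _)) (plain_upto_mem (k := _))) => m s.
  exact: over_upto_odd.
by rewrite /plain_upto /no_overlined /= eqxx andbF.
Qed.

Lemma plain_gf_over k :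
  odd k.+1 -> 'X^N %| plain_gf k.+1 - (over_gf k + 'X^(k.+1) * plain_gf k.+1).
Proof.
move=> odd_k.
apply: (gf_cons L_uniq (plain_upto_mem (k := _)) (plain_upto_mem (k := _))) => m s.
  exact: plain_upto_odd.
by rewrite over_uptoE /= ltnn.
Qed.

(** Only the odd part [2K+1] contributes to a step, through [(1 + x1) / (1 - x1)]. The numerator is
    the same as for [pod], which lets it drop out of the comparison. *)
Lemma over_gf_prod K :
  'X^N %| over_gf (2 * K) * odd_prod 'X K - distinct_odd_prod K.
Proof.
elim: K => [|K IHK].
  rewrite /odd_prod /distinct_odd_prod !big_ord0 mulr1.
  apply: gf_delta => m lt_mN; rewrite (eq_count (over_upto0 m)).
  case: m lt_mN => [|m] lt_mN; last first.
    by rewrite (@eq_count _ _ pred0) ?count_pred0 // => s; rewrite andbF.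
  rewrite (@eq_count _ _ (pred1 [::])) => [|s]; last by rewrite andbT.
  by rewrite count_uniq_mem // (mem_L lt_mN).
have odd_k : odd (2 * K).+1 by rewrite /= oddM.
have := plain_gf_over odd_k; have := over_gf_plain odd_k.
have -> : over_gf (2 * K.+1) = over_gf (2 * K).+1.
  rewrite /over_gf mulnS add2n; apply/polyP => m; rewrite !coef_poly.
  by case: ifP => // _; congr _%:R; apply: eq_count => s; rewrite over_upto_even //= oddM.
rewrite odd_prodS /distinct_odd_prod big_ord_recr -/(distinct_odd_prod K) /=.
set p1 := over_gf _.+1; set p := plain_gf _.
move: IHK; set p0 := over_gf _.
set B := odd_prod _ _; set O := distinct_odd_prod _ => h0 h2 h1.
set x1 := 'X^(_.+1) in h1 h2 *.
rewrite (_ : _ - _ = (p1 - (p + x1 * p)) * (B * (1 - x1))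
  + (p - (p0 + x1 * p)) * (B * (1 + x1)) + (p0 * B - O) * (1 + x1)); last by ring.
by do ![apply: dvdp_add]; apply: dvdp_mulr.
Qed.

End Over.

End GeneratingFunctions.

(** * From truncated series back to the partition counts *)

Lemma pod_upto_le k m s : (m <= k)%N -> pod_upto k m s = is_pod m s.
Proof.
move=> le_mk; rewrite /pod_upto; case: (boolP (is_pod m s)) => //= pod_s.
case/andP: pod_s => /is_partition_part_le part_s _.
by apply: sub_all part_s => x /leq_trans; apply.
Qed.

Lemma over_upto_le k m s :
  (m <= k)%N -> over_upto k m s = is_odd_overpartition m s.
Proof.
move=> le_mk; rewrite /over_upto; case: (boolP (is_odd_overpartition m s)) => //= over_s.
case/andP: over_s => /andP[/is_partition_part_le part_s _] _.
by apply: sub_all part_s => x /leq_trans; apply.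
Qed.

Lemma pod_natE (L : seq (seq nat)) m :
  uniq L -> {subset is_pod m <= L} -> pod_nat m = count (is_pod m) L.
Proof.
move=> L_uniq mem_L; apply: (sum_card_tuples val_inj) => // s /andP[part_s _].
by split; [apply: is_partition_size part_s | apply: is_partition_ord].
Qed.

Lemma overp_oddE (L : seq (seq (nat * bool))) m :
  uniq L -> {subset is_odd_overpartition m <= L} ->
  overp_odd m = count (is_odd_overpartition m) L.
Proof.
move=> L_uniq mem_L; have f_inj : injective (fun x : 'I_m.+1 * bool => (val x.1, x.2)).
  by move=> [i b] [j c] /= [/val_inj -> ->].
apply: (sum_card_tuples f_inj) => // s /andP[/andP[part_s _] _].
split; first by rewrite -(size_map fst) (is_partition_size part_s).
have /allP le_sm := is_partition_part_le part_s.
exists [seq (inord x.1, x.2) | x <- s]; rewrite -map_comp map_id_in // => -[x b] xs /=.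
by rewrite inordK // ltnS; apply: le_sm; apply: (map_f fst xs).
Qed.

(** A single duplicate-free list serving all integers [m <= n] at once. *)
Definition partition_candidates n : seq (seq nat) :=
  undup (bounded_seqs (iota 0 n.+1) n).

Definition flagged_candidates n : seq (seq (nat * bool)) :=
  undup (bounded_seqs [seq (x, b) | x <- iota 0 n.+1, b <- [:: true; false]] n).

Lemma mem_partition_candidates n m s :
  (m < n.+1)%N -> is_partition m s -> s \in partition_candidates n.
Proof.
rewrite ltnS => le_mn part_s; rewrite mem_undup; apply: mem_bounded_seqs.
  apply: sub_all (is_partition_part_le part_s) => x /= le_xm.
  by rewrite -[_ :: _]/(iota 0 n.+1) mem_iota ltnS (leq_trans le_xm).
exact: leq_trans (is_partition_size part_s) le_mn.
Qed.

Lemma mem_flagged_candidates n m s :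
  (m < n.+1)%N -> is_partition m (unzip1 s) -> s \in flagged_candidates n.
Proof.
rewrite ltnS => le_mn part_s; rewrite mem_undup; apply: mem_bounded_seqs.
  have := is_partition_part_le part_s; rewrite all_map.
  apply: sub_all => -[x b] le_xm; apply/allpairsP; exists (x, b).
  by split=> //; [rewrite mem_iota ltnS (leq_trans le_xm) | by case: (b)].
by rewrite -(size_map fst) (leq_trans (is_partition_size part_s)).
Qed.

Lemma overp_odd_sum n :
  overp_odd n = (\sum_(j < 2 * n.+1)
    (if triangular j <= n then pod_nat (n - triangular j) else 0))%N.
Proof.
(* [N = n.+1] is the least precision that retains the coefficient of index [n]; parts up to [2 * N]
   then include all that can occur. *)
pose N := n.+1; pose L1 := partition_candidates n; pose L2 := flagged_candidates n.
have L1_uniq : uniq L1 by apply: undup_uniq.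
have L2_uniq : uniq L2 by apply: undup_uniq.
have podE m : (m < N)%N -> count (pod_upto (2 * N) m) L1 = pod_nat m.
  move=> lt_mN; rewrite (@pod_natE L1) // => [|s /andP[part_s _]]; last first.
    exact: mem_partition_candidates lt_mN part_s.
  by apply: eq_count => s; rewrite pod_upto_le //; lia.
have overE : count (over_upto (2 * N) n) L2 = overp_odd n.
  rewrite (@overp_oddE L2) // => [|s /andP[/andP[part_s _] _]]; last first.
    exact: mem_flagged_candidates (ltnSn n) part_s.
  by apply: eq_count => s; rewrite over_upto_le //; rewrite /N; lia.
have := over_gf_prod L2_uniq (@mem_flagged_candidates n) N.
have := pod_gf_prod L1_uniq (@mem_partition_candidates n) N.
have := gauss_mod N.
set D := odd_prod _ _; set A := even_prod _ _ _; set O := distinct_odd_prod _.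
set T := \sum_(k < _) _; set F := gf _ _; set G := gf _ _ => hT hF hG.
(* Modulo ['X^N], [G D = O = F A] and [D T = A], so [D (G - F T)] vanishes; [D] has constant term 1
   and cancels. *)
have /dvdp_XnP/(_ n (ltnSn n)) : 'X^N %| G - F * T.
  apply: (@dvdp_Xn_cancel _ D).
    rewrite /D /odd_prod horner_prod big1 ?oner_neq0 // => k _.
    by rewrite hornerD hornerN hornerXn hornerC expr0n subr0.
  rewrite (_ : D * _ = G * D - O - (F * A - O) - F * (D * T - A)); last by ring.
  by apply: dvdp_sub; [apply: dvdp_sub | apply: dvdp_mull].
rewrite coefB coef_poly ltnSn overE => /eqP; rewrite subr_eq0 => /eqP overT.
(* The coefficients are rational, so the equality of naturals is tested in [rat]. *)
apply/eqP; rewrite -(eqr_nat rat) overT mulr_sumr coef_sum natr_sum; apply/eqP.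
apply: eq_bigr => j _; rewrite coefMXn ltnNge.
have lt_njN : (n - triangular j < N)%N by rewrite ltnS leq_subr.
by case: leqP => //= _; rewrite coef_poly lt_njN podE.
Qed.

(** * Passage to the sum over all natural numbers *)

Local Open Scope classical_set_scope.
Local Open Scope ring_scope.

Theorem theorem4p8 (n : nat) :
  overp_odd n = \sum_(j \in [set: nat]) pod (n%:Z - ((j * (j + 1)) %/ 2)%N%:Z).
Proof.
rewrite overp_odd_sum.
(* For [n < triangular j] the argument is a negative integer, where [pod] is 0. *)
have podB j : pod (n%:Z - (triangular j)%:Z)
    = (if triangular j <= n then pod_nat (n - triangular j) else 0)%N.
  case: leqP => [le_jn|lt_nj]; first by rewrite subzn.
  by rewrite -opprB subzn 1?ltnW //; case: (_ - _)%N (subn_gt0 n (triangular j)) => [|k];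
    rewrite lt_nj.
under eq_bigr do rewrite -podB.
rewrite (@fsbig_ord _ _ _ _ (fun j => pod (n%:Z - (triangular j)%:Z))).
(* An index [j >= 2 * n.+1] adds nothing, as [triangular j >= j > n]. *)
apply: fsbig_widen => // j [_ /= /negP]; rewrite -leqNgt => le_Nj.
by rewrite /preimage /= podB leqNgt (leq_trans _ (leq_triangular j)) //; lia.
Qed.
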